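(* Let $m\ge2$. If an $m$-strategy CRS game with $C$, $R$, $S$ all nonempty has at least one pair of nodes $(u,v)$ forming the local structure $M^*$, then the game does not admit a pure strategy Nash equilibrium (PNE).
   Context: An $m$-strategy CRS game consists of a finite set of players $N=C\cup R\cup S$ (disjoint union of conformists $C$, rebels $R$ and stubborn agents $S$), a set $E\neq\emptyset$ of undirected edges on $N$ without loops, and a strategy set $A=\{a_1,\dots,a_m\}$ common to all players. $N_i=\{j: ij\in E\}$ is the set of neighbors of $i$. Each stubborn agent has a predetermined fixed strategy in $A$ which it never changes, so strategy profiles $\boldsymbol x\in A^N$ always have $x_i$ equal to the fixed strategy for $i\in S$. Payoffs are $u_i(\boldsymbol x)=|\{j\in N_i: x_j=x_i\}|$ for $i\in C$, $u_i(\boldsymbol x)=|\{j\in N_i: x_j\ne x_i\}|$ for $i\in R$, and $u_i(\boldsymbol x)=0$ for $i\in S$. A profile $\boldsymbol x^*$ is a PNE if no conformist or rebel $i$ can strictly increase $u_i$ by unilaterally changing its strategy: $u_i(\boldsymbol x^* )\ge u_i(x_i,\boldsymbol x^*_{-i})$ for all $x_i\in A$. A pair of nodes $(u,v)$ forms the local structure $M^*$ if there exist integers $k_u,k_v\ge0$ such that: $u\in C$, and the neighbors of $u$ are exactly one rebel, namely $v$, together with $mk_u$ stubborn agents, exactly $k_u$ of whom have fixed strategy $a$ for each $a\in A$; and $v\in R$, and the neighbors of $v$ are exactly one conformist, namely $u$, together with $mk_v$ stubborn agents, exactly $k_v$ of whom have fixed strategy $a$ for each $a\in A$. *)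

(* Defs.v *)
From mathcomp Require Import all_boot.

Set Implicit Arguments.
Unset Strict Implicit.
Unset Printing Implicit Defensive.

(* An undirected edge without loop is a two-element set of players.
   Only the values of [fixed_strategy] on [stubborn] are meaningful. *)
Record crs_game (m : nat) (N A : finType) := CRSGame {
  conformists : {set N};
  rebels : {set N};
  stubborn : {set N};
  edges : {set {set N}};
  fixed_strategy : N -> A;
  card_strategies : #|A| = m;
  players_cover : conformists :|: rebels :|: stubborn = [set: N];
  disjoint_CR : [disjoint conformists & rebels];
  disjoint_CS : [disjoint conformists & stubborn];
  disjoint_RS : [disjoint rebels & stubborn];
  edges_nonempty : edges != set0;
  edges_card2 : forall e : {set N}, e \in edges -> #|e| = 2
}.

Definition neighbors m (N A : finType) (G : crs_game m N A) (i : N) : {set N} :=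
  [set j | [set i; j] \in edges G].

Definition is_profile m (N A : finType) (G : crs_game m N A)
    (x : {ffun N -> A}) : Prop :=
  forall i : N, i \in stubborn G -> x i = fixed_strategy G i.

Definition payoff m (N A : finType) (G : crs_game m N A)
    (x : {ffun N -> A}) (i : N) : nat :=
  if i \in conformists G then #|[set j in neighbors G i | x j == x i]|
  else if i \in rebels G then #|[set j in neighbors G i | x j != x i]|
  else 0.

Definition deviate (N A : finType) (x : {ffun N -> A}) (i : N) (a : A) :
    {ffun N -> A} :=
  [ffun j => if j == i then a else x j].

Definition is_PNE m (N A : finType) (G : crs_game m N A)
    (x : {ffun N -> A}) : Prop :=
  is_profile G x /\
  forall i : N, i \in conformists G :|: rebels G ->
  forall a : A, payoff G (deviate x i a) i <= payoff G x i.

Definition balanced_stubborn_neighbors m (N A : finType) (G : crs_game m N A)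
    (i : N) (k : nat) : Prop :=
  #|neighbors G i :&: stubborn G| = m * k /\
  forall a : A,
    #|[set j in neighbors G i :&: stubborn G | fixed_strategy G j == a]| = k.

Definition local_structure_Mstar m (N A : finType) (G : crs_game m N A)
    (u v : N) : Prop :=
  exists ku kv : nat,
    [/\ u \in conformists G,
        neighbors G u :&: rebels G = [set v],
        neighbors G u :&: conformists G = set0
      & balanced_stubborn_neighbors G u ku] /\
    [/\ v \in rebels G,
        neighbors G v :&: conformists G = [set u],
        neighbors G v :&: rebels G = set0
      & balanced_stubborn_neighbors G v kv].

(* Main.v *)
Require Import Defs.
From mathcomp Require Import all_boot.

Set Implicit Arguments.
Unset Strict Implicit.
Unset Printing Implicit Defensive.

(* The balanced stubborn neighbors of [u] and [v] contribute the same amount to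
   every strategy, so [u] and [v] play matching pennies with each other: [u]
   strictly gains by copying [v] unless they already agree, and [v] strictly
   gains by moving away from [u] unless they already disagree. *)

Lemma neighbors_irrefl (m : nat) (N A : finType) (G : crs_game m N A) (i : N) :
  i \notin neighbors G i.
Proof.
by rewrite inE setUid; apply/negP => /edges_card2; rewrite cards1.
Qed.

Lemma neighbors_split (m : nat) (N A : finType) (G : crs_game m N A) (i : N) :
  neighbors G i = (neighbors G i :&: conformists G)
    :|: (neighbors G i :&: rebels G) :|: (neighbors G i :&: stubborn G).
Proof. by rewrite -!setIUr players_cover setIT. Qed.

Lemma deviate_id (N A : finType) (x : {ffun N -> A}) (i : N) :
  deviate x i (x i) = x.
Proof. by apply/ffunP => j; rewrite ffunE; case: eqP => // ->. Qed.

(** There are no loops, so [i] is not its own neighbor and the deviation leaves every neighbor's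
    strategy as in [x]. *)
Lemma payoff_deviate_conformist (m : nat) (N A : finType)
    (G : crs_game m N A) (x : {ffun N -> A}) (i : N) (a : A) :
  i \in conformists G ->
  payoff G (deviate x i a) i = #|[set j in neighbors G i | x j == a]|.
Proof.
move=> iC; rewrite /payoff iC; apply: eq_card => j; rewrite !in_set !ffunE eqxx.
by case: (j =P i) => // ->; move: (neighbors_irrefl G i); rewrite inE => /negPf ->.
Qed.

(** Taking the complement within the neighborhood reduces the rebel's payoff to the same count as
    for a conformist, with the order reversed. *)
Lemma payoff_deviate_rebel (m : nat) (N A : finType)
    (G : crs_game m N A) (x : {ffun N -> A}) (i : N) (a : A) :
  i \in rebels G ->
  payoff G (deviate x i a) i =
    #|neighbors G i| - #|[set j in neighbors G i | x j == a]|.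
Proof.
move=> iR; rewrite /payoff iR (disjointFl (disjoint_CR G) iR).
rewrite -(cardsID [set j | x j == a] (neighbors G i)).
rewrite [in X in _ - X]setIdE addKn.
apply: eq_card => j; rewrite !in_set !ffunE eqxx andbC.
case: (j =P i) => // ->; move: (neighbors_irrefl G i).
by rewrite inE => /negPf ->; rewrite !andbF.
Qed.

(** The only non-stubborn neighbor [w] contributes the boolean, read as 0 or 1; the stubborn ones
    keep their fixed strategies in a profile, hence contribute [k] whatever [a] is. *)
Lemma card_neighbors_playing (m : nat) (N A : finType) (G : crs_game m N A)
    (x : {ffun N -> A}) (i w : N) (k : nat) (a : A) :
  is_profile G x -> w \notin stubborn G ->
  neighbors G i = w |: (neighbors G i :&: stubborn G) ->
  balanced_stubborn_neighbors G i k ->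
  #|[set j in neighbors G i | x j == a]| = (x w == a) + k.
Proof.
move=> xP wS iE [_ /(_ a) <-].
rewrite (cardsD1 w) in_set {1}iE setU11; congr (_ + _); apply: eq_card => j.
rewrite in_setD1 in_set iE !in_set in_set1.
have [->|_] /= := eqVneq j w; first by rewrite (negPf wS).
by case jS: (j \in stubborn G); rewrite ?andbF ?andbT // xP.
Qed.

Theorem lemma1 (m : nat) (hm : 2 <= m) (N A : finType) (G : crs_game m N A)
    (hC : conformists G != set0) (hR : rebels G != set0)
    (hS : stubborn G != set0)
    (hM : exists u v : N, local_structure_Mstar G u v) :
  ~ exists x : {ffun N -> A}, is_PNE G x.
Proof.
case=> x [xP xNE].
case: hM => u [v [ku [kv [[uC uR uC0 uB] [vR vC vR0 vB]]]]].
have uE : neighbors G u = v |: (neighbors G u :&: stubborn G).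
  by rewrite {1}neighbors_split uC0 uR set0U.
have vE : neighbors G v = u |: (neighbors G v :&: stubborn G).
  by rewrite {1}neighbors_split vR0 vC setU0.
have uS : u \notin stubborn G by rewrite (disjointFr (disjoint_CS G) uC).
have vS : v \notin stubborn G by rewrite (disjointFr (disjoint_RS G) vR).
have xuv : x v == x u.
  have : payoff G (deviate x u (x v)) u <= payoff G x u.
    by apply: xNE; rewrite inE uC.
  (* The current payoff is viewed as that of the trivial deviation, so one formula covers both
     sides. *)
  rewrite -[in X in _ <= X](deviate_id x u) !payoff_deviate_conformist //.
  rewrite !(card_neighbors_playing _ xP vS uE uB) // eqxx leq_add2r.
  by case: (x v == x u).
(* A second strategy exists because [m] is at least 2. *)
have [a xua] : exists a, x u != a.
  have : 0 < #|~: [set x u]|.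
    by rewrite cardsC1 (card_strategies G) -subn1 subn_gt0.
  by case/card_gt0P => a; rewrite !inE eq_sym; exists a.
have : payoff G (deviate x v a) v <= payoff G x v.
  by apply: xNE; rewrite inE vR orbT.
rewrite -[in X in _ <= X](deviate_id x v) !payoff_deviate_rebel //.
have cP b := card_neighbors_playing b xP uS vE vB.
(* Subtraction is truncated: cancelling the degree of [v] requires a count bounded by it. *)
rewrite leq_sub2lE; last first.
  by apply/subset_leq_card/subsetP => j; rewrite inE => /andP[].
(* Agreement with [u] puts [kv + 1] neighbors on the current strategy of [v] but only [kv] on [a],
   so the inequality would say [kv + 1 <= kv]. *)
by rewrite !cP (negPf xua) (eqP xuv) eqxx ltnn.
Qed.
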